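(* Let $(X,+,d)$ and $(Y,+,\rho)$ be metric abelian groups such that $X$ is unbounded by $d$. Let $\varepsilon\geq 0$ and assume that $f\colon X\to Y$ possesses the following asymptotic stability property: $$\limsup_{\min(\|x\|_d,\|y\|_d)\to\infty}\|f(x+y)-f(x)-f(y)\|_\rho\leq\varepsilon. \quad (A)$$ Then $$\|f(x+y)-f(x)-f(y)\|_\rho\leq 5\varepsilon\qquad\text{for all }x,y\in X. \quad (B)$$ Furthermore, provided that (A) holds, the constant $5\varepsilon$ is the smallest possible in (B).
   Context: A metric abelian group is a triple $(X,+,d)$ where $(X,+)$ is an abelian group equipped with a translation invariant metric $d$ (i.e. $d(x+z,y+z)=d(x,y)$ for all $x,y,z\in X$). Write $\|x\|_d:=d(x,0)$, and similarly $\|y\|_\rho:=\rho(y,0)$ on $Y$; this is an even subadditive function, not necessarily positively homogeneous. ''$X$ is unbounded by $d$'' means $\sup_{x\in X}\|x\|_d=\infty$. For a real-valued function $F$ on $X\times X$, $\limsup_{\min(\|x\|_d,\|y\|_d)\to\infty}F(x,y)$ denotes $\inf_{r>0}\sup\{F(x,y): x,y\in X,\ \|x\|_d\geq r,\ \|y\|_d\geq r\}$ in the extended reals. *)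

(* Defs.v *)
From mathcomp Require Import all_boot all_order all_algebra.
From mathcomp Require Import all_classical all_reals all_analysis.

Set Implicit Arguments.
Unset Strict Implicit.
Unset Printing Implicit Defensive.

Import Order.TTheory GRing.Theory Num.Theory.

Local Open Scope classical_set_scope.
Local Open Scope ring_scope.

(* The metric is an explicit argument because no MathComp structure fits: the
   norms of normed Z-modules satisfy [`|x *+ n| = `|x| *+ n], which a
   translation invariant metric need not satisfy, and HB rejects a new join of
   [zmodType] with [metricType] above the existing hierarchy. *)
Record invariant_metric (R : realType) (X : zmodType) (d : X -> X -> R) : Prop :=
  InvariantMetric {
    metric_refl : forall x, d x x = 0;
    metric_eq : forall x y, d x y = 0 -> x = y;
    metric_sym : forall x y, d x y = d y x;
    metric_triangle : forall y x z, d x z <= d x y + d y z;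
    metric_invariant : forall x y z, d (x + z) (y + z) = d x y
  }.

Section MetricGroup.
Context {R : realType}.

Definition dnorm (X : zmodType) (d : X -> X -> R) (x : X) : R := d x 0.

Definition unbounded (X : zmodType) (d : X -> X -> R) : Prop :=
  ereal_sup [set (dnorm d x)%:E | x in [set: X]] = +oo%E.

Definition limsup_min (X : zmodType) (d : X -> X -> R) (F : X -> X -> R) :
    \bar R :=
  ereal_inf [set ereal_sup [set (F p.1 p.2)%:E |
                            p in [set p : X * X | r <= dnorm d p.1 /\
                                                  r <= dnorm d p.2]] |
             r in [set r : R | 0 < r]].

End MetricGroup.

(* Main.v *)
(* For [u], [v] and [u + v] far from [0], the Cauchy difference of [f] at
   [(x, y)] is a signed sum of the Cauchy differences at
   [(x + y + u + v, - u - v)], [(x + u, y + v)], [(- u, - v)], [(x + u, - u)]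
   and [(y + v, - v)], whose arguments are all far from [0]; hence the factor 5.
   It is attained on the integers by [f 1 = 3 eps] and [f n = eps] for
   [n != 1]: away from [0] all Cauchy differences are [eps] or [- eps], while
   at [(1, 1)] the value is [eps - 3 eps - 3 eps]. *)
Require Import Defs.
From mathcomp Require Import all_boot all_order all_algebra.
From mathcomp Require Import all_classical all_reals all_analysis.
From mathcomp Require Import lra.

Set Implicit Arguments.
Unset Strict Implicit.
Unset Printing Implicit Defensive.

Import Order.TTheory GRing.Theory Num.Theory.

Local Open Scope classical_set_scope.
Local Open Scope ring_scope.

Section DnormTheory.
Context (R : realType) (X : zmodType) (d : X -> X -> R).
Hypothesis dP : invariant_metric d.

Lemma dnormN (x : X) : dnorm d (- x) = dnorm d x.
Proof.
by rewrite /dnorm -(metric_invariant dP (- x) 0 x) addNr add0r (Defs.metric_sym dP).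
Qed.

Lemma ler_dnormD (x y : X) : dnorm d (x + y) <= dnorm d x + dnorm d y.
Proof.
apply: le_trans (Defs.metric_triangle dP y _ _) _.
by rewrite lerD2r -{2}[y]add0r (metric_invariant dP).
Qed.

Lemma ler_dnormB (x y : X) : dnorm d (x - y) <= dnorm d x + dnorm d y.
Proof. by rewrite -(dnormN y) ler_dnormD. Qed.

(** Reverse triangle inequality, used to keep a sum far from [0] when one summand is far and the
    other is controlled. *)
Lemma lerB_dnormD (x y : X) : dnorm d y - dnorm d x <= dnorm d (x + y).
Proof.
rewrite lerBlDr; have := ler_dnormB (x + y) x.
by rewrite [x + y]addrC addrK.
Qed.

(** Nonnegativity is not a field of [invariant_metric]; it follows from [x - x = 0], whose norm is
    at most twice that of [x]. *)
Lemma dnorm_ge0 (x : X) : 0 <= dnorm d x.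
Proof.
have := ler_dnormB x x; rewrite subrr {1}/dnorm (metric_refl dP); lra.
Qed.

Lemma unbounded_dnorm_gt (M : R) : unbounded d -> exists x, M < dnorm d x.
Proof.
move=> dU; have : (M%:E < ereal_sup [set (dnorm d x)%:E | x in [set: X]])%E.
  by rewrite dU ltry.
by move=> /ereal_sup_gt[_ [x _ <-]]; rewrite lte_fin => Mx; exists x.
Qed.

End DnormTheory.

(** The infimum over radii need not be attained, so a uniform bound at some radius is only available
    strictly above [a]. *)
Lemma limsup_min_le_near (R : realType) (X : zmodType) (d : X -> X -> R)
    (F : X -> X -> R) (a b : R) :
  (limsup_min d F <= a%:E)%E -> a < b ->
  exists r : R, forall x y : X, r <= dnorm d x -> r <= dnorm d y -> F x y <= b.
Proof.
move=> Fa ab; have : (limsup_min d F < b%:E)%E.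
  by apply: le_lt_trans Fa _; rewrite lte_fin.
move=> /ereal_inf_lt[_ [r _ <-]] /ltW supb; exists r => x y rx ry.
rewrite -lee_fin; apply: le_trans supb; apply: ereal_sup_ubound.
by exists (x, y).
Qed.

(** A single radius suffices, the limsup being an infimum over all radii. *)
Lemma limsup_min_le (R : realType) (X : zmodType) (d : X -> X -> R)
    (F : X -> X -> R) (a r : R) : 0 < r ->
  (forall x y : X, r <= dnorm d x -> r <= dnorm d y -> F x y <= a) ->
  (limsup_min d F <= a%:E)%E.
Proof.
move=> r0 Fa; apply: (@le_trans _ _ (ereal_sup [set (F p.1 p.2)%:E |
    p in [set p : X * X | r <= dnorm d p.1 /\ r <= dnorm d p.2]])).
  by apply: ereal_inf_lbound; exists r.
by apply: ge_ereal_sup => _ [[x y] /= [rx ry] <-]; rewrite lee_fin Fa.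
Qed.

Definition cauchy_diff {X Y : zmodType} (f : X -> Y) (x y : X) : Y :=
  f (x + y) - f x - f y.

Lemma cauchy_diff5 (X Y : zmodType) (f : X -> Y) (x y u v : X) :
  cauchy_diff f x y =
    cauchy_diff f ((x + y) + (u + v)) (- (u + v))
    + cauchy_diff f (x + u) (y + v) + cauchy_diff f (- u) (- v)
    - cauchy_diff f (x + u) (- u) - cauchy_diff f (y + v) (- v).
Proof.
rewrite /cauchy_diff !addrK -opprD [x + u + (y + v)]addrACA.
set s := f (x + y + (u + v)); set p := f (x + u); set q := f (y + v).
set n := f (- (u + v)); set a := f (x + y).
set U := f (- u); set V := f (- v).
have DE : (f x - p - U) + (f y - q - V) = f x + f y - (p + q) - (U + V).
  by rewrite addrACA [f x - p + _]addrACA -!opprD.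
rewrite -[RHS]addrA -opprD DE -[s - p - q]addrA -[n - U - V]addrA -!opprD.
(* The two subtracted differences, regrouped by [DE], move to the left-hand side. There [f x + f y]
   cancels; on the right the sum telescopes through [s] and [n]. *)
apply: (addIr (f x + f y - (p + q) - (U + V))); rewrite subrK.
rewrite -[a - f x - f y]addrA -opprD -[f x + f y - _ - _]addrA subrKA.
by rewrite [a - s - n]addrAC subrKA [a - n - _]addrAC subrKA addrA.
Qed.

Lemma cauchy_diff_le_asymptotic (R : realType) (eps : R) (X Y : zmodType)
    (d : X -> X -> R) (rho : Y -> Y -> R) (f : X -> Y) :
  invariant_metric d -> invariant_metric rho -> unbounded d ->
  (limsup_min d (fun x y => dnorm rho (cauchy_diff f x y)) <= eps%:E)%E ->
  forall x y : X, dnorm rho (cauchy_diff f x y) <= 5 * eps.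
Proof.
move=> dP rhoP dU feps x y; apply/ler_addgt0Pr => e e0.
(* Five differences enter the estimate, so each may exceed [eps] by [e / 5]. *)
have /(limsup_min_le_near feps)[r fr] : eps < eps + e / 5 by lra.
(* The margin over [r] absorbs the shift of [u] by [x] and of [v] by [y]. The extra [dnorm d u]
   required of [v] keeps [u + v] far enough to absorb [x + y] as well. *)
have [u ub] := unbounded_dnorm_gt (r + dnorm d x + dnorm d y) dU.
have [v vb] := unbounded_dnorm_gt (r + dnorm d x + dnorm d y + dnorm d u) dU.
have x0 := dnorm_ge0 dP x; have y0 := dnorm_ge0 dP y.
have u0 := dnorm_ge0 dP u.
have uv := lerB_dnormD dP u v.
have xy := ler_dnormD dP x y.
have xu := lerB_dnormD dP x u.
have yv := lerB_dnormD dP y v.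
have xyuv := lerB_dnormD dP (x + y) (u + v).
have c1 : dnorm rho (cauchy_diff f ((x + y) + (u + v)) (- (u + v)))
          <= eps + e / 5 by apply: fr; rewrite ?(dnormN dP); lra.
have c2 : dnorm rho (cauchy_diff f (x + u) (y + v)) <= eps + e / 5.
  by apply: fr; lra.
have c3 : dnorm rho (cauchy_diff f (- u) (- v)) <= eps + e / 5.
  by apply: fr; rewrite (dnormN dP); lra.
have c4 : dnorm rho (cauchy_diff f (x + u) (- u)) <= eps + e / 5.
  by apply: fr; rewrite ?(dnormN dP); lra.
have c5 : dnorm rho (cauchy_diff f (y + v) (- v)) <= eps + e / 5.
  by apply: fr; rewrite ?(dnormN dP); lra.
rewrite (cauchy_diff5 f x y u v).
apply: le_trans (ler_dnormB rhoP _ _) _.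
have := ler_dnormB rhoP (cauchy_diff f ((x + y) + (u + v)) (- (u + v))
    + cauchy_diff f (x + u) (y + v) + cauchy_diff f (- u) (- v))
  (cauchy_diff f (x + u) (- u)).
have := ler_dnormD rhoP (cauchy_diff f ((x + y) + (u + v)) (- (u + v))
    + cauchy_diff f (x + u) (y + v)) (cauchy_diff f (- u) (- v)).
have := ler_dnormD rhoP (cauchy_diff f ((x + y) + (u + v)) (- (u + v)))
  (cauchy_diff f (x + u) (y + v)).
lra.
Qed.

(** Common form of both metrics of the extremal example: translation invariance is automatic, and
    the metric axioms reduce to properties of [N]. *)
Definition norm_dist {R : realType} {X : zmodType} (N : X -> R) (x y : X) : R :=
  N (x - y).

Lemma norm_dist_invariant_metric (R : realType) (X : zmodType) (N : X -> R) :
  N 0 = 0 -> (forall x, N x = 0 -> x = 0) -> (forall x, N (- x) = N x) ->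
  (forall x y, N (x + y) <= N x + N y) -> invariant_metric (norm_dist N).
Proof.
move=> N0 N0_eq0 NN ND; split; rewrite /norm_dist.
- by move=> x; rewrite subrr.
- by move=> x y /N0_eq0/eqP; rewrite subr_eq0 => /eqP.
- by move=> x y; rewrite -NN opprB.
- by move=> y x z; rewrite -[x - z](subrKA y).
- by move=> x y z; rewrite opprD addrACA subrr addr0.
Qed.

Lemma dnorm_norm_dist (R : realType) (X : zmodType) (N : X -> R) (x : X) :
  dnorm (norm_dist N) x = N x.
Proof. by rewrite /dnorm /norm_dist subr0. Qed.

Definition int_norm {R : realType} (n : int) : R := `|n|%:~R.

(** If [m] and [n] differ from [1] but [m + n = 1], the Cauchy difference is the value at [1] minus
    [2 * eps]. Hence [3 * eps] is the largest value at [1] that keeps it at most [eps]. *)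
Definition spike {R : realType} (eps : R) (n : int) : R :=
  if n == 1 then 3 * eps else eps.

Lemma int_norm_dist_invariant_metric (R : realType) :
  invariant_metric (norm_dist (@int_norm R)).
Proof.
apply: norm_dist_invariant_metric; rewrite /int_norm.
- by rewrite normr0.
- by move=> n /eqP; rewrite intr_eq0 normr_eq0 => /eqP.
- by move=> n; rewrite normrN.
- by move=> m n; rewrite -intrD ler_int ler_normD.
Qed.

Lemma real_norm_dist_invariant_metric (R : realType) :
  invariant_metric (norm_dist (Num.norm : R -> R)).
Proof.
apply: norm_dist_invariant_metric.
- exact: normr0.
- exact: normr0_eq0.
- exact: normrN.
- exact: ler_normD.
Qed.

Lemma int_norm_dist_unbounded (R : realType) :
  unbounded (norm_dist (@int_norm R)).
Proof.
(* The Archimedean bound of [A] is an integer whose norm exceeds [A]. *)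
apply/eqyP => A A0; apply: (@le_trans _ _ (dnorm (norm_dist (@int_norm R))
    (Num.bound A)%:Z)%:E).
  rewrite lee_fin dnorm_norm_dist /int_norm.
  by apply: ltW; exact: archi_boundP (ltW A0).
by apply: ereal_sup_ubound; exists (Num.bound A)%:Z.
Qed.

Lemma norm_cauchy_diff_spike (R : realType) (eps : R) (m n : int) : 0 <= eps ->
  m != 1 -> n != 1 -> `|cauchy_diff (spike eps) m n| <= eps.
Proof.
move=> eps0 /negbTE m1 /negbTE n1; rewrite /cauchy_diff /spike m1 n1 ler_norml.
by case: ifP => _; lra.
Qed.

Lemma norm_cauchy_diff_spike11 (R : realType) (eps : R) : 0 <= eps ->
  `|cauchy_diff (spike eps) 1 1| = 5 * eps.
Proof.
move=> eps0; rewrite /cauchy_diff /spike !eqxx /=.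
rewrite ler0_norm; lra.
Qed.

Theorem theorem1 (R : realType) (eps : R) (eps_ge0 : 0 <= eps) :
  (forall (X Y : zmodType) (d : X -> X -> R) (rho : Y -> Y -> R) (f : X -> Y),
     invariant_metric d -> invariant_metric rho -> unbounded d ->
     (limsup_min d (fun x y => dnorm rho (f (x + y) - f x - f y)%R) <= eps%:E)%E ->
     forall x y : X, dnorm rho (f (x + y) - f x - f y) <= 5 * eps) /\
  (exists (X Y : zmodType) (d : X -> X -> R) (rho : Y -> Y -> R) (f : X -> Y),
     [/\ invariant_metric d, invariant_metric rho, unbounded d,
         (limsup_min d (fun x y => dnorm rho (f (x + y) - f x - f y)%R) <= eps%:E)%E &
         forall c : R,
           (forall x y : X, dnorm rho (f (x + y) - f x - f y) <= c) ->
           5 * eps <= c]).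
Proof.
split=> [X Y d rho f|]; first exact: cauchy_diff_le_asymptotic.
exists int, R, (norm_dist int_norm), (norm_dist Num.norm), (spike eps); split.
- exact: int_norm_dist_invariant_metric.
- exact: real_norm_dist_invariant_metric.
- exact: int_norm_dist_unbounded.
(* Radius [2] already excludes the exceptional point [1] from both arguments; their sum may still be
   [1]. *)
- have neq1 (n : int) : 2 <= dnorm (norm_dist (@int_norm R)) n -> n != 1.
    by rewrite dnorm_norm_dist /int_norm (ler_int R 2); apply: contraTneq => ->.
  apply: (@limsup_min_le _ _ _ _ _ 2) => // m n /neq1 m1 /neq1 n1.
  by rewrite dnorm_norm_dist; exact: norm_cauchy_diff_spike.
(* Every admissible [c] is tested at the pair [(1, 1)], where the norm is exactly [5 * eps]. *)
- move=> c /(_ 1 1); rewrite dnorm_norm_dist.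
  by rewrite -/(cauchy_diff _ _ _) norm_cauchy_diff_spike11.
Qed.
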